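(* Let $f:\mathbb{R}^d\to\mathbb{R}$ be differentiable, convex and $L$-smooth ($L>0$), with nonempty set of minimizers and minimum value $f^*$. Let $(\rho_t)_{t\ge0}$ be a sequence with $\rho_t\ge0$ and $\rho_{t+1}\le\rho_t$ for all $t$, and $\rho_t\to0$. Let $x^0\in\mathbb{R}^d$ and let $(x^t)_{t\ge 0}$ be generated by deterministic USAM with the Polyak scheduler, i.e. for $t\ge0$ $$e^t=x^t+\rho_t\nabla f(x^t),\qquad \gamma_t=\frac{f(e^t)-f^*-\rho_t\langle\nabla f(e^t),\nabla f(x^t)\rangle}{\|\nabla f(e^t)\|^2},\qquad x^{t+1}=x^t-\gamma_t\nabla f(e^t).$$ Then $\sum_{t=0}^{\infty}\left(f(x^t)-f^*\right)<\infty$, and consequently $f(x^t)\to f^*$ as $t\to\infty$.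
   Context: $\|\cdot\|$ is the Euclidean norm. $f$ is $L$-smooth if $\|\nabla f(x)-\nabla f(y)\|\le L\|x-y\|$ for all $x,y$. Convention: if $\nabla f(x^t)=0$ then $x^t$ is a minimizer, the algorithm terminates, and we set $x^{s}=x^t$ for all $s\ge t$. *)

(* Defs.v *)
From HB Require Import structures.
From mathcomp Require Import all_boot all_order all_algebra.
From mathcomp Require Import all_classical all_reals all_analysis.

Set Implicit Arguments.
Unset Strict Implicit.
Unset Printing Implicit Defensive.

Import Order.TTheory GRing.Theory Num.Theory.
Import numFieldNormedType.Exports.

Local Open Scope classical_set_scope.
Local Open Scope ring_scope.

Definition dotp (R : realType) (d : nat) (u v : 'rV[R]_d) : R :=
  \sum_(i < d) u 0 i * v 0 i.

(* The library norm `|u| on 'rV[R]_d is the sup norm. It induces the same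
   topology, hence the same notion of differentiability. *)
Definition enorm (R : realType) (d : nat) (u : 'rV[R]_d) : R :=
  Num.sqrt (dotp u u).

Definition grad (R : realType) (d : nat) (f : 'rV[R]_d -> R) (x : 'rV[R]_d) :
    'rV[R]_d :=
  \row_(i < d) 'D_(delta_mx 0 i) f x.

Definition smooth (R : realType) (d : nat) (L : R) (f : 'rV[R]_d -> R) : Prop :=
  forall x y, enorm (grad f x - grad f y) <= L * enorm (x - y).

Definition argmin (R : realType) (T : Type) (f : T -> R) : set T :=
  [set x | forall y, f x <= f y].

Definition usam_perturb (R : realType) (d : nat) (f : 'rV[R]_d -> R)
    (rho : R) (x : 'rV[R]_d) : 'rV[R]_d :=
  x + rho *: grad f x.

Definition polyak_step (R : realType) (d : nat) (f : 'rV[R]_d -> R)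
    (fstar rho : R) (x : 'rV[R]_d) : R :=
  let e := usam_perturb f rho x in
  (f e - fstar - rho * dotp (grad f e) (grad f x)) / enorm (grad f e) ^+ 2.

(* The iterates stay constant from the first time the gradient vanishes. For f
   convex and smooth with 0 <= rho t, a nonzero gradient at x t forces a nonzero
   gradient at the perturbed point, so the update never divides by zero. *)
Definition usam_polyak (R : realType) (d : nat) (f : 'rV[R]_d -> R) (fstar : R)
    (rho : nat -> R) (x : nat -> 'rV[R]_d) : Prop :=
  forall t : nat,
    (grad f (x t) = 0 -> forall s : nat, (t <= s)%N -> x s = x t) /\
    (grad f (x t) <> 0 ->
      x t.+1 = x t - polyak_step f fstar (rho t) (x t) *:
                       grad f (usam_perturb f (rho t) (x t))).

(* Main.v *)
Require Import Defs.
From HB Require Import structures.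
From mathcomp Require Import all_boot all_order all_algebra.
From mathcomp Require Import ring lra.
From mathcomp Require Import all_classical all_reals all_analysis.

Set Implicit Arguments.
Unset Strict Implicit.
Unset Printing Implicit Defensive.

Import Order.TTheory GRing.Theory Num.Theory.
Import numFieldNormedType.Exports.

Local Open Scope classical_set_scope.
Local Open Scope ring_scope.

(** Write g and h for the gradients at x and at e = x + rho g, and N for the
    numerator of the Polyak step. Convexity at e gives N <= <h, x - z> for a
    minimizer z, so as soon as 0 <= N the squared distance to z drops by at
    least N^2 / |h|^2 in one step. Smoothness gives N >= f(x) - f_min - L
    rho^2 |g|^2 and |g|^2 <= 4 L (f(x) - f_min); hence, once L rho <= 1/4, N
    is at least 3/4 (f(x) - f_min) and |h|^2 is at most 12 L (f(x) - f_min),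
    so the drop is at least (f(x) - f_min) / (32 L). Only finitely many steps
    have L rho > 1/4, and the drops telescope. *)

Section Dotp.
Variables (R : realType) (d : nat).
Implicit Types u v w : 'rV[R]_d.

Lemma dotpC u v : dotp u v = dotp v u.
Proof. by apply: eq_bigr => i _; rewrite mulrC. Qed.

Lemma dotpDl u v w : dotp (u + v) w = dotp u w + dotp v w.
Proof. by rewrite -big_split; apply: eq_bigr => i _; rewrite mxE mulrDl. Qed.

Lemma dotpZl a u v : dotp (a *: u) v = a * dotp u v.
Proof. by rewrite mulr_sumr; apply: eq_bigr => i _; rewrite mxE mulrA. Qed.

Lemma dotpNl u v : dotp (- u) v = - dotp u v.
Proof. by rewrite -scaleN1r dotpZl mulN1r. Qed.

Lemma dotp0l v : dotp 0 v = 0.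
Proof. by rewrite -(scale0r 0) dotpZl mul0r. Qed.

Lemma dotpDr u v w : dotp u (v + w) = dotp u v + dotp u w.
Proof. by rewrite !(dotpC u) dotpDl. Qed.

Lemma dotpZr a u v : dotp u (a *: v) = a * dotp u v.
Proof. by rewrite !(dotpC u) dotpZl. Qed.

Lemma dotpNr u v : dotp u (- v) = - dotp u v.
Proof. by rewrite !(dotpC u) dotpNl. Qed.

Definition dotpE := (dotpDl, dotpDr, dotpNl, dotpNr, dotpZl, dotpZr).

Lemma dotp_ge0 u : 0 <= dotp u u.
Proof. by apply: sumr_ge0 => i _; rewrite -expr2 sqr_ge0. Qed.

Lemma dotp_eq0 u : (dotp u u == 0) = (u == 0).
Proof.
apply/eqP/eqP => [|->]; last exact: dotp0l.
move/eqP; rewrite psumr_eq0 => [/allP u0|i _]; last by rewrite -expr2 sqr_ge0.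
apply/rowP => i; have /= := u0 i (mem_index_enum _).
by rewrite mxE -expr2 sqrf_eq0 => /eqP.
Qed.

Lemma sqr_enorm u : enorm u ^+ 2 = dotp u u.
Proof. by rewrite sqr_sqrtr ?dotp_ge0. Qed.

Lemma enorm_ge0 u : 0 <= enorm u.
Proof. exact: sqrtr_ge0. Qed.

(** Squaring the smoothness bound turns the later estimates into polynomial inequalities between
    inner products. *)
Lemma smooth_dotp (L : R) (f : 'rV[R]_d -> R) u v : smooth L f ->
  dotp (grad f u - grad f v) (grad f u - grad f v) <=
    L ^+ 2 * dotp (u - v) (u - v).
Proof.
move=> /(_ u v) fL; rewrite -!sqr_enorm -exprMn lerXn2r ?nnegrE ?enorm_ge0//.
by rewrite (le_trans _ fL) ?enorm_ge0.
Qed.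

End Dotp.

Section Convex.
Variables (R : realType) (d : nat) (f : 'rV[R]_d -> R).

Lemma derive_grad u v : differentiable f u -> 'D_v f u = dotp (grad f u) v.
Proof.
move=> fu; rewrite deriveE// [in LHS](row_sum_delta v) linear_sum.
by apply: eq_bigr => i _; rewrite linearZ/= mxE deriveE// mulrC.
Qed.

Hypothesis f_convex : convex_function setT f.

Lemma convex_grad u v : differentiable f u ->
  f u + dotp (grad f u) (v - u) <= f v.
Proof.
move=> fu; rewrite -derive_grad// addrC -lerBrDr.
(* Convexity bounds the difference quotient only for steps in []0, 1]], so the derivative is read as
   a limit from the right. *)
have fuv := cvg_dnbhs_at_right (@diff_derivable _ _ _ _ _ (v - u) fu).
rewrite /derive -(cvg_lim _ fuv)//; apply: limr_le; first exact: cvgP fuv.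
near=> h.
have h0 : 0 < h by near: h; exact: nbhs_right_gt.
have h1 : h <= 1 by near: h; exact: nbhs_right_le.
have := f_convex (Itv01 (ltW h0) h1) (in_setT v) (in_setT u).
rewrite convRE /conv/= /unstable.onem scalerBl scale1r addrCA addrC.
rewrite -scalerBr => fh.
by rewrite ler_pdivrMl//; lra.
Unshelve. all: by end_near. Qed.

Hypothesis f_diff : forall u, differentiable f u.
Variable L : R.
Hypothesis L_gt0 : 0 < L.
Hypothesis f_smooth : smooth L f.

(* The constant is L instead of the usual L / 2: the bound follows from
   convexity at v and Young's inequality, without integrating the gradient. *)
Lemma descent u v :
  f v <= f u + dotp (grad f u) (v - u) + L * dotp (v - u) (v - u).
Proof.
have := convex_grad u (f_diff v); rewrite -(opprB v u).
have := smooth_dotp v u f_smooth.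
have := dotp_ge0 (grad f v - grad f u - L *: (v - u)).
move: (v - u) (grad f u) (grad f v) => w g h.
rewrite !dotpE (dotpC g h) (dotpC w h) (dotpC w g) => young hg fuv.
(* The factor [L] matches the cross term of [young], so the goal becomes linear in [young] and
   [hg]. *)
suff : L * (dotp h w - dotp g w - L * dotp w w) <= 0.
  by rewrite pmulr_rle0//; lra.
by lra.
Qed.

(** A gradient step of length [1 / (2 * L)] minimizes the bound of [descent], lowering it by
    [|grad f u|^2 / (4 * L)], yet the value reached is at least [m]. *)
Lemma dotp_grad_le m u : (forall v, m <= f v) ->
  dotp (grad f u) (grad f u) <= 4 * L * (f u - m).
Proof.
move=> fm; pose c := (2 * L)^-1.
have := le_trans (fm _) (descent u (u - c *: grad f u)).
rewrite [u - _]addrC addrK !dotpE.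
set q := dotp _ _ => mle.
have -> : q = 4 * L * (c * q - L * (c * (c * q)))
  by rewrite /c; field; exact: lt0r_neq0.
by rewrite ler_pM2l; [lra|exact: mulr_gt0].
Qed.

Lemma usam_polyak_decrease (x xstar : 'rV[R]_d) (rho : R) :
    argmin f xstar -> 0 <= rho -> L * rho <= 4^-1 -> grad f x <> 0 ->
  let x' := x - polyak_step f (f xstar) rho x *:
                  grad f (usam_perturb f rho x) in
  dotp (x' - xstar) (x' - xstar) + (f x - f xstar) / (32 * L) <=
    dotp (x - xstar) (x - xstar).
Proof.
move=> fxstar rho0 Lrho /eqP; rewrite -dotp_eq0 => g_neq0 /=.
have := dotp_grad_le x fxstar.
(* Based at the perturbed point, this bound contains the same term [- rho * <h, g>] as the Polyak
   numerator; hence the lower bound [Nge]. *)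
have := descent (usam_perturb f rho x) x.
have := smooth_dotp (usam_perturb f rho x) x f_smooth.
have := convex_grad xstar (f_diff (usam_perturb f rho x)).
have := fxstar x.
rewrite /polyak_step sqr_enorm.
have -> : x - usam_perturb f rho x = - rho *: grad f x.
  by rewrite /usam_perturb opprD addNKr scaleNr.
have -> : usam_perturb f rho x - x = rho *: grad f x.
  by rewrite /usam_perturb addrC addKr.
have -> : xstar - usam_perturb f rho x = - (x - xstar) - rho *: grad f x.
  by rewrite /usam_perturb opprD opprB addrA.
have : 0 < dotp (grad f x) (grad f x).
  by rewrite lt_neqAle eq_sym g_neq0 dotp_ge0.
move: (grad f x) (grad f (usam_perturb f rho x)) (f (usam_perturb f rho x)).
move=> g h fe.
(* Two Young inequalities for [<h, g>]: with [|h - g|^2 <= |g|^2 / 16], the first keeps [|h|^2]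
   positive and the second gives [|h|^2 <= 3 |g|^2]. *)
have := dotp_ge0 (h - 2^-1 *: g); have := dotp_ge0 (h - 2 *: g).
rewrite [x - _ - _]addrAC; move: (x - xstar) => w.
rewrite !dotpE (dotpC g h) (dotpC w h).
move: (dotp g g) (dotp h h) (dotp h g) (dotp h w) (dotp w w) => G H P W w2.
set delta := f x - f xstar; set N := fe - f xstar - rho * P.
move=> Hle Hge G0 fle convx hg desc Gle.
have Lrho2 : (L * rho) ^+ 2 <= 16^-1.
  by have := mulr_ge0 (ltW L_gt0) rho0; nra.
have hgG : H - 2 * P + G <= 16^-1 * G.
  by rewrite (le_trans _ (ler_wpM2r (ltW G0) Lrho2))//; lra.
have H0 : 0 < H by lra.
have H3 : H <= 12 * (L * delta) by lra.
have delta0 : 0 <= delta by rewrite subr_ge0.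
have NW : N <= W by rewrite /N; lra.
have rhoG : L * rho ^+ 2 * G <= 4^-1 * delta.
  have := ler_wpM2r delta0 Lrho2.
  have : L * rho ^+ 2 * G <= L * rho ^+ 2 * (4 * L * delta).
    by rewrite ler_wpM2l// mulr_ge0 ?sqr_ge0// ltW.
  by lra.
have Nge : 3 / 4 * delta <= N by move: rhoG; rewrite /N /delta; lra.
have N0 : 0 <= N by lra.
(* [Nge] and [H3] would even allow [3 * delta / (64 * L)]; [32] is a rounder constant. *)
have step : delta / (32 * L) <= N ^+ 2 / H.
  rewrite ler_pdivrMr ?mulr_gt0// mulrAC ler_pdivlMr//.
  have : (3 / 4 * delta) ^+ 2 <= N ^+ 2 by rewrite lerXn2r ?nnegrE//; lra.
  move=> /(ler_wpM2r (ltW L_gt0)) N2.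
  have := ler_wpM2l delta0 H3.
  have : 0 <= delta ^+ 2 * L by rewrite mulr_ge0 ?sqr_ge0// ltW.
  by lra.
(* In the expanded square the cross term is then at most [- 2 * N ^+ 2 / H], while the quadratic
   term adds back [N ^+ 2 / H]. *)
have : N / H * N <= N / H * W by rewrite ler_wpM2l// divr_ge0// ltW.
rewrite divfK ?lt0r_neq0//; have : N / H * N = N ^+ 2 / H by rewrite mulrAC.
by lra.
Qed.

End Convex.

Theorem theorem3p4 (R : realType) (d : nat) (f : 'rV[R]_d -> R) (L fstar : R)
    (rho : nat -> R) (x0 : 'rV[R]_d) (x : nat -> 'rV[R]_d)
    (f_diff : forall y, differentiable f y)
    (f_convex : convex_function setT f)
    (L_gt0 : 0 < L)
    (f_smooth : smooth L f)
    (argmin_nonempty : argmin f !=set0)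
    (fstarE : forall y, argmin f y -> fstar = f y)
    (rho_ge0 : forall t, 0 <= rho t)
    (rho_nonincr : forall t, rho t.+1 <= rho t)
    (rho_cvg0 : rho t @[t --> \oo] --> 0)
    (x_init : x 0%N = x0)
    (x_usam : usam_polyak f fstar rho x) :
  cvgn (series (fun t => f (x t) - fstar)) /\
  f (x t) @[t --> \oo] --> fstar.
Proof.
have [xstar fxstar] := argmin_nonempty.
rewrite (fstarE _ fxstar) in x_usam *.
pose u t := f (x t) - f xstar.
pose D t := dotp (x t - xstar) (x t - xstar).
have u_ge0 t : 0 <= u t by rewrite subr_ge0.
have rho_small : \forall t \near \oo, L * rho t <= 4^-1.
  have L4 : 0 < (4 * L)^-1 by rewrite invr_gt0 mulr_gt0.
  near=> t; rewrite mulrC -ler_pdivlMr// -invfM.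
  by near: t; exact: (cvgr_le 0 rho_cvg0).
have [T _ rhoT] := rho_small.
have D_decr t : (T <= t)%N -> D t.+1 + u t / (32 * L) <= D t.
  move=> /rhoT Lrho; have [g0|g0] := eqVneq (grad f (x t)) 0.
    (* The iterates are frozen here, and by convexity a stationary point is a minimizer, so no drop
       is required. *)
    have [/(_ g0 t.+1 (leqnSn t)) xt _] := x_usam t.
    have := convex_grad f_convex xstar (f_diff (x t)).
    rewrite g0 dotp0l addr0 => fle.
    have -> : u t = 0 by apply/eqP; rewrite eq_le u_ge0 subr_le0 fle.
    by rewrite mul0r addr0 /D xt.
  have [_ xt] := x_usam t; rewrite /D xt; last exact/eqP.
  apply: (usam_polyak_decrease f_convex f_diff L_gt0 f_smooth) => //.
  exact/eqP.
have sum_le n : \sum_(T <= t < T + n) u t <= 32 * L * (D T - D (T + n)%N).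
  elim: n => [|n IHn]; first by rewrite addn0 big_geq// subrr mulr0.
  have := D_decr (T + n)%N (leq_addr _ _).
  rewrite addnS big_nat_recr ?leq_addr//= -lerBrDl ler_pdivrMr ?mulr_gt0//.
  by lra.
have cvgu : cvgn (series u).
  (* Dropping the first [T] terms, where no decrease is known, preserves convergence; the remaining
     partial sums are monotone and bounded by telescoping. *)
  rewrite -(is_cvg_series_restrict T); apply: nondecreasing_is_cvgn.
    apply/nondecreasing_seqP => n /=; have [Tn|nT] := leqP T n.
      by rewrite big_nat_recr//= lerDl.
    by rewrite !big_geq// ltnW.
  exists (32 * L * D T) => _ [n _ <-] /=.
  have D0 t : 0 <= D t by exact: dotp_ge0.
  have [Tn|/ltnW nT] := leqP T n.
    by rewrite -(subnKC Tn) (le_trans (sum_le _))// ler_pM2l ?mulr_gt0// gerBl.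
  by rewrite big_geq// !mulr_ge0// ltW.
by split=> //; apply/subr_cvg0; exact: cvg_series_cvg_0.
Unshelve. all: by end_near. Qed.
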